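(* Let $k$ be an arbitrary field (of any characteristic), let $X$ be an affine variety over $k$, let $\phi: X\to X$ be a morphism, let $\alpha\in X$ be a point, and let $V$ be a Zariski-closed subset of $X$. Then $\{n\in\mathbb{N}\mid\phi^n(\alpha)\in V\}=A\cup B$, where $A\subseteq\mathbb{N}$ is a (possibly empty) finite union of infinite arithmetic progressions, and $B\subseteq\mathbb{N}$ is a set of Banach density zero.
   Context: An affine variety over a field $k$ means $X=\mathrm{Spec}(R)$ for a finitely generated (commutative, unital) $k$-algebra $R$; no irreducibility or reducedness is assumed. A morphism $\phi:X\to X$ is a morphism of $k$-schemes, i.e. it is given by $\phi(\mathfrak{p})=\Phi^{-1}(\mathfrak{p})$ for a $k$-algebra homomorphism $\Phi:R\to R$. A point of $X$ is any element of $\mathrm{Spec}(R)$ (a prime ideal of $R$), not assumed to be a closed point. $\mathbb{N}$ denotes the set of nonnegative integers, and $\phi^n=\phi\circ\cdots\circ\phi$ is the $n$-fold composition of $\phi$ with itself ($\phi^0$ is the identity). An infinite arithmetic progression is a set of the form $a\mathbb{N}+b=\{a\ell+b\mid \ell\in\mathbb{N}\}$ with integers $a\geq 1$ and $b\geq 0$. The Banach density of a subset $S\subseteq\mathbb{N}$ is $$d(S)=\limsup_{|I|\to+\infty}\frac{|S\cap I|}{|I|},$$ the limit supremum taken over all (finite, nonempty) intervals $I$ of consecutive integers in $\mathbb{N}$ with $|I|\to+\infty$. *)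

(* Defs.v *)
From HB Require Import structures.
From mathcomp Require Import all_boot all_order all_algebra ring_quotient.
From mathcomp Require Import all_classical all_reals topology normedtype.

Set Implicit Arguments.
Unset Strict Implicit.
Unset Printing Implicit Defensive.

Import Order.TTheory GRing.Theory Num.Theory.

Local Open Scope classical_set_scope.
Local Open Scope ring_scope.

Definition fin_gen_alg (k : fieldType) (R : comAlgType k) : Prop :=
  exists s : seq R, forall S : {pred R},
    GRing.subalg_closed S -> {subset s <= S} -> forall x, x \in S.

(* [prime_idealr] asks for a proper ideal closed under subtraction and under
   multiplication by R, such that [u * v] in it forces [u] or [v] in it.  The
   zero ring is not a [comNzRingType]; its spectrum would be empty. *)
Definition spec (R : comNzRingType) : Type := prime_idealr R.

Definition spec_ideal (R : comNzRingType) (p : spec R) : set R :=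
  [set x | x \in (p : prime_idealr R)].

HB.instance Definition _ (R : comNzRingType) := gen_eqMixin (spec R).
HB.instance Definition _ (R : comNzRingType) := gen_choiceMixin (spec R).

Section Zariski.
Variable R : comNzRingType.
Implicit Types (E : set R) (p : spec R).

Definition zero_locus E : set (spec R) := [set p | E `<=` spec_ideal p].

Definition zariski_open (U : set (spec R)) : Prop :=
  exists E, ~` U = zero_locus E.

Lemma zariski_openT : zariski_open setT.
Proof.
exists setT; rewrite setCT; apply/seteqP; split=> // p /(_ 1 I).
by rewrite /spec_ideal /= idealr1.
Qed.

Lemma zariski_openI : setI_closed zariski_open.
Proof.
move=> A B [E hE] [F hF].
exists [set x | exists u v, [/\ E u, F v & x = u * v]].
rewrite setCI hE hF; apply/seteqP; split=> p.
  move=> pEF x [u [v [Eu Fv ->]]]; rewrite /spec_ideal /= prime_idealrM.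
  by apply/orP; case: pEF => h; [left; apply: h | right; apply: h].
move=> pEF; have [pE|/existsNP[u /not_implyP[Eu pu]]] := pselect (E `<=` spec_ideal p).
  by left.
right=> v Fv; have := pEF (u * v).
rewrite /spec_ideal /= prime_idealrM => /(_ _)/orP[|//|//].
by exists u, v.
Qed.

Lemma zariski_open_bigU (I : Type) (f : I -> set (spec R)) :
  (forall i, zariski_open (f i)) -> zariski_open (\bigcup_i f i).
Proof.
move=> /choice[E hE]; exists (\bigcup_i E i).
rewrite setC_bigcup; apply/seteqP; split=> p h.
  by move=> x [i _ Eix]; have := h i Logic.I; rewrite hE; apply.
by move=> i _; rewrite hE => x Eix; apply: h; exists i.
Qed.

HB.instance Definition _ := isOpenTopological.Build (spec R)
  zariski_openT zariski_openI zariski_open_bigU.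

Lemma zariski_closedP (V : set (spec R)) :
  closed V <-> exists E, V = zero_locus E.
Proof.
rewrite -openC; split=> -[E hE]; exists E; first by rewrite -hE setCK.
by rewrite setCK.
Qed.

End Zariski.

Section SpecMap.
Variables (k : fieldType) (R : comAlgType k) (Phi : {lrmorphism R -> R}).
Variable p : spec R.

Definition comap_ideal : {pred R} := fun x => Phi x \in (p : prime_idealr R).

Lemma mem_comap x : (x \in comap_ideal) = (Phi x \in (p : prime_idealr R)).
Proof. by []. Qed.

Lemma comap_idealr_closed : idealr_closed comap_ideal.
Proof.
split; rewrite ?mem_comap ?rmorph0 ?rmorph1; first exact: idealr0.
  by rewrite idealr1.
move=> a u v; rewrite !mem_comap rmorphD rmorphM => pu pv.
by apply: rpredD => //; apply: idealMr.
Qed.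

Lemma comap_prime_idealr_closed : prime_idealr_closed comap_ideal.
Proof. by move=> u v; rewrite !mem_comap rmorphM prime_idealrM. Qed.

HB.instance Definition _ := isIdealr.Build R comap_ideal comap_idealr_closed.
HB.instance Definition _ :=
  isPrimeIdealrClosed.Build R comap_ideal comap_prime_idealr_closed.

Definition spec_map : spec R := (comap_ideal : prime_idealr R).

Lemma spec_mapE : spec_ideal spec_map = Phi @^-1` spec_ideal p.
Proof. by []. Qed.

End SpecMap.

Definition arith_prog (a b : nat) : set nat := range (fun l => a * l + b)%N.

Definition fin_union_arith_prog (A : set nat) : Prop :=
  exists s : seq (nat * nat),
    (forall ab, ab \in s -> (0 < ab.1)%N) /\
    A = \bigcup_(ab in [set` s]) arith_prog ab.1 ab.2.

(* The pair [(a, m)] stands for the interval {a, ..., a + m - 1} of length m;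
   only lengths tending to infinity matter, so m = 0 is harmless. *)
Definition interval_filter : set_system (nat * nat) :=
  [set P | exists M : nat, forall a m : nat, (M <= m)%N -> P (a, m)].

Definition interval_ratio (K : realType) (S : set nat) (I : nat * nat) : K :=
  (\sum_(I.1 <= i < I.1 + I.2 | i \in S) 1)%N%:R / I.2%:R.

Definition banach_density (K : realType) (S : set nat) : \bar K :=
  limf_esup (fun I => (interval_ratio K S I)%:E) interval_filter.

(* Main.v *)
(* By the Hilbert basis theorem, Spec R is a Noetherian topological space, and
   [spec_map Phi] is continuous; nothing else about R is used.  If the return
   times S of a point to a closed set W do not have density zero, then neither
   does S `&` (S - j) for some j > 0, and this is the set of return times to
   W `&` phi^{-j} W.  For a minimal such W this forces phi^j W `<=` W, so S
   contains an arithmetic progression.  The full decomposition then follows by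
   Noetherian induction on the closure of the orbit. *)
Require Import Defs.
From HB Require Import structures.
From mathcomp Require Import all_boot all_order all_algebra ring_quotient.
From mathcomp Require Import all_classical all_reals topology normedtype ereal.
From mathcomp Require Import zify.

Import Order.TTheory GRing.Theory Num.Theory.

Local Open Scope classical_set_scope.
Local Open Scope ring_scope.

(** * Counting in windows, and sets of Banach density zero *)

Definition hits (S : set nat) (a m : nat) : nat :=
  count (fun i => i \in S) (iota a m).

Lemma hits_add S a m n : hits S a (m + n) = (hits S a m + hits S (a + m) n)%N.
Proof. by rewrite /hits iotaD count_cat. Qed.

Lemma sub_hits S S' a m : S `<=` S' -> (hits S a m <= hits S' a m)%N.
Proof. by move=> SS'; apply: sub_count => i; rewrite !in_setE; apply: SS'. Qed.

Lemma hits_setU S S' a m : (hits (S `|` S') a m <= hits S a m + hits S' a m)%N.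
Proof.
rewrite /hits -count_predUI; apply: leq_trans (leq_addr _ _).
by apply: sub_count => i /=; rewrite in_setU.
Qed.

Lemma hits_le S a m : (hits S a m <= m)%N.
Proof. by rewrite -[leqRHS](size_iota a); apply: count_size. Qed.

(** Division-free form of vanishing Banach density: for each [k > 0], every long enough window has
    ratio at most [1/k], uniformly in its start [a]. *)
Definition zero_density (S : set nat) : Prop :=
  forall k : nat, exists M : nat, forall a m : nat, (M <= m)%N ->
    (hits S a m * k <= m)%N.

Lemma banach_density_eq0 (K : realType) S :
  zero_density S -> banach_density K S = 0%E.
Proof.
move=> zS; have ratioE I : interval_ratio K S I = (hits S I.1 I.2)%:R / I.2%:R.
  by rewrite /interval_ratio sum1_count /index_iota addKn.
apply/eqP; rewrite eq_le; apply/andP; split.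
  apply/lee_addgt0Pr => e e0; rewrite add0e.
  (* This integer exceeds [1/e], so its inverse is below [e]. *)
  have [M hM] := zS (Num.truncn e^-1).+1.
  apply: (@le_trans _ _ (ereal_sup
    ((fun I => (interval_ratio K S I)%:E) @` [set I | (M <= I.2)%N]))).
    by apply: ereal_inf_lbound; exists [set I | (M <= I.2)%N] => //=; exists M.
  apply: ge_ereal_sup => _ [[a m] /= Mm <-]; rewrite lee_fin ratioE /=.
  have [->|m0] := posnP m; first by rewrite invr0 mulr0 ltW.
  rewrite ler_pdivrMr ?ltr0n//.
  have := hM a m Mm; rewrite -(ler_nat K) natrM => hle.
  have lte := truncnS_gt e^-1.
  rewrite -ler_pdivrMl//; apply: le_trans hle.
  by rewrite mulrC ler_wpM2l// ltW.
apply: le_ereal_inf_tmp => _ [P [M hM] <-].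
apply: le_trans (ereal_sup_ubound _); last by exists (0, M)%N => //; apply: hM.
by rewrite lee_fin ratioE divr_ge0.
Qed.

Lemma zero_density_sub S S' : S `<=` S' -> zero_density S' -> zero_density S.
Proof.
move=> SS' zS' k; have [M hM] := zS' k; exists M => a m Mm.
by apply: leq_trans (hM a m Mm); rewrite leq_mul2r sub_hits ?orbT.
Qed.

Lemma zero_densityU S S' :
  zero_density S -> zero_density S' -> zero_density (S `|` S').
Proof.
move=> zS zS' k; have [M hM] := zS (2 * k)%N; have [M' hM'] := zS' (2 * k)%N.
exists (maxn M M') => a m; rewrite geq_max => /andP[Mm M'm].
by have := hM a m Mm; have := hM' a m M'm; have := hits_setU S S' a m; nia.
Qed.

Lemma zero_density_lt N : zero_density [set n | (n < N)%N].
Proof.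
move=> k; exists (N * k)%N => a m; apply: leq_trans.
rewrite leq_mul2r; apply/orP; right; rewrite -[leqRHS](size_iota 0) /hits.
rewrite -size_filter; apply: uniq_leq_size; first by rewrite filter_uniq ?iota_uniq.
by move=> i; rewrite mem_filter !mem_iota => /andP[/set_mem].
Qed.

Lemma zero_density0 : zero_density set0.
Proof. by apply: (@zero_density_sub _ _ _ (zero_density_lt 0)) => n []. Qed.

(** As [b] is positive, the hits of the image in a window of length [m] come from elements of [S] in
    a window of the same length, starting at the least [a'] with [a <= b * a' + r]. *)
Lemma zero_density_affine (b r : nat) S : (0 < b)%N ->
  zero_density S -> zero_density ((fun l => b * l + r)%N @` S).
Proof.
move=> b0 zS k; have [M hM] := zS k; exists M => a m /hM {}hM.
have ex : exists l, (a <= b * l + r)%N by exists a; nia.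
case: (ex_minnP ex) => a' ha' mina'; apply: leq_trans (hM a').
rewrite leq_mul2r; apply/orP; right; rewrite /hits -!size_filter.
rewrite -[leqRHS](size_map (fun l => b * l + r)%N).
apply: uniq_leq_size; first by rewrite filter_uniq ?iota_uniq.
move=> i; rewrite mem_filter mem_iota => /andP[/set_mem[l Sl <-] /andP[al lm]].
apply: map_f; rewrite mem_filter mem_set// mem_iota mina'//=.
by have := mina' _ al; nia.
Qed.

(* At most one point of a set with gaps larger than [K] lies in any interval of
   length [K]. *)
Lemma zero_density_shift S :
  (forall j, (0 < j)%N -> zero_density (S `&` [set n | S (n + j)%N])) ->
  zero_density S.
Proof.
(* [T] collects the points of [S] that recur within [K] steps. After multiplying by [k], the hits of
   [T], the full blocks of length [K] and the one extra block each cost at most [m/4]. *)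
move=> zS k; pose K := (4 * k).+1.
pose T := [set n | S n /\ exists2 j, (0 < j <= K)%N & S (n + j)%N].
have zT : zero_density T.
  (* [T] is a finite union over the shifts [j] up to [K], added one at a time. *)
  rewrite /T; elim: {T}K => [|K IH].
    by apply: zero_density_sub zero_density0 => n [_ [j]]; lia.
  apply: zero_density_sub (zero_densityU _ _ IH (zS K.+1 isT)) => n.
  move=> [Sn [j /andP[j0]]]; rewrite leq_eqVlt => /orP[/eqP->|jK] Snj.
    by right.
  by left; split=> //; exists j => //; rewrite j0.
have hitsD a m : (m <= K)%N -> (hits (S `\` T) a m <= 1)%N.
  move=> mK; rewrite leqNgt /hits -size_filter; apply/negP.
  case E : [seq i <- _ | _] => [//|x [//|y s]] _.
  have := sorted_filter ltn_trans (fun i => i \in S `\` T) (iota_ltn_sorted a m).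
  have := mem_filter (fun i => i \in S `\` T) ^~ (iota a m).
  rewrite E => mE /= /andP[xy _].
  have := mE x; have := mE y; rewrite !(inE, mem_iota) !eqxx !orbT.
  move=> /esym/andP[/set_mem[Sy _] /andP[_ ym]].
  move=> /esym/andP[/set_mem[Sx nTx] /andP[ax _]]; apply: nTx; split=> //.
  by exists (y - x)%N; [lia | rewrite subnKC// ltnW].
have hitsDm q : forall a m, (m <= K * q)%N -> (hits (S `\` T) a m <= q)%N.
  elim: q => [|q IH] a m mq; first by apply: leq_trans (hits_le _ _ _) _; lia.
  have [/hitsD|/ltnW Km] := leqP m K; first by move=> /(_ a) /leq_trans->.
  rewrite -(subnKC Km) hits_add.
  have /(IH (a + K)%N) : (m - K <= K * q)%N by lia.
  by have := hitsD a K (leqnn _); lia.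
have [M hM] := zT (4 * k)%N.
exists (maxn M (4 * k)) => a m; rewrite geq_max => /andP[/hM-/(_ a) hT km].
have hS : (hits S a m <= hits T a m + hits (S `\` T) a m)%N.
  apply: leq_trans (hits_setU _ _ _ _); apply: sub_hits => n Sn.
  by have [|] := pselect (T n); [left | right].
have := hitsDm (m %/ K).+1 a m; rewrite mulnS mulnC => /(_ _) hD.
have {}hD := hD ltac:(have := divn_eq m K; have := ltn_pmod m (ltn0Sn (4 * k)); rewrite -/K; lia).
have := leq_divM m K; rewrite /K in hD *.
nia.
Qed.

(** * Closure properties of unions of progressions up to density zero *)

Definition ap_mod_zero (S : set nat) : Prop :=
  exists A B : set nat,
    [/\ S = A `|` B, fin_union_arith_prog A & zero_density B].

Lemma fin_union_arith_prog0 : fin_union_arith_prog set0.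
Proof. by exists [::]; split=> //; rewrite set_nil bigcup_set0. Qed.

Lemma ap_mod_zero_zero S : zero_density S -> ap_mod_zero S.
Proof.
by move=> zS; exists set0, S; split=> //; [rewrite set0U | apply: fin_union_arith_prog0].
Qed.

Lemma ap_mod_zeroU S S' : ap_mod_zero S -> ap_mod_zero S' -> ap_mod_zero (S `|` S').
Proof.
move=> [A [B [-> [s [s0 ->]] zB]]] [A' [B' [-> [s' [s'0 ->]] zB']]].
exists (\bigcup_(ab in [set` s ++ s']) arith_prog ab.1 ab.2), (B `|` B'); split.
- rewrite setUACA -bigcup_setU; congr (bigcup _ _ `|` _).
  by apply/seteqP; split=> ab /=; rewrite mem_cat => /orP.
- exists (s ++ s'); split=> // ab; rewrite mem_cat => /orP[/s0|/s'0] //.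
- exact: zero_densityU.
Qed.

Lemma ap_mod_zero_affine (b r : nat) S : (0 < b)%N ->
  ap_mod_zero S -> ap_mod_zero ((fun l => b * l + r)%N @` S).
Proof.
move=> b0 [A [B [-> [s [s0 ->]] zB]]].
exists ((fun l => b * l + r)%N @` \bigcup_(ab in [set` s]) arith_prog ab.1 ab.2).
exists ((fun l => b * l + r)%N @` B); split; last exact: zero_density_affine.
  exact: image_setU.
exists [seq (b * ab.1, b * ab.2 + r)%N | ab <- s]; split.
  by move=> _ /mapP[ab /s0 a0 ->] /=; rewrite muln_gt0 b0.
apply/seteqP; split=> [_ [_ [ab abs [l _ <-]] <-]|n [_ /mapP[ab abs ->]] [l _ <-]] /=.
  exists (b * ab.1, b * ab.2 + r)%N; first exact: map_f.
  by exists l; rewrite //= mulnDr mulnA addnA.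
exists (ab.1 * l + ab.2)%N; last by rewrite mulnDr mulnA addnA.
by exists ab => //; exists l.
Qed.

(** [S] is reassembled from its residue classes mod [b], adding one class, an affine image, at each
    step. *)
Lemma ap_mod_zero_residues (b : nat) S : (0 < b)%N ->
  (forall r, ap_mod_zero [set l | S (b * l + r)%N]) -> ap_mod_zero S.
Proof.
move=> b0 hS; suff h t : ap_mod_zero (S `&` [set n | (n %% b < t)%N]).
  rewrite (_ : S = S `&` [set n | (n %% b < b)%N]); first exact: h.
  by apply/seteqP; split=> [n Sn|n []//]; split=> //=; rewrite ltn_pmod.
elim: t => [|t IH].
  by apply: ap_mod_zero_zero; apply: zero_density_sub zero_density0 => n [].
have := ap_mod_zeroU _ _ IH (ap_mod_zero_affine b t _ b0 (hS t)).
have [tb|bt] := ltnP t b.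
  congr ap_mod_zero; apply/seteqP; split=> n.
    move=> [[Sn /= nt]|[l Sl <-]]; first by split=> //=; apply: ltnW.
    by split=> //=; rewrite mulnC modnMDl modn_small.
  move=> [Sn /=]; rewrite ltnS leq_eqVlt => /orP[/eqP nt|]; last by left.
  by right; exists (n %/ b)%N; rewrite /= -?nt mulnC -divn_eq.
(* Once [t >= b], every residue has been included and nothing changes. *)
move=> _; move: IH; congr ap_mod_zero; apply/seteqP.
by split=> n [Sn /= nt]; split=> //=; have := ltn_pmod n b0; lia.
Qed.

Lemma ap_mod_zero_cofinite N S : (forall n, (N <= n)%N -> S n) -> ap_mod_zero S.
Proof.
move=> NS; exists (arith_prog 1 N), (S `&` [set n | (n < N)%N]); split.
- apply/seteqP; split=> n; last by move=> [[l _ <-]|[]//]; apply: NS; lia.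
  move=> Sn; have [nN|Nn] := ltnP n N; [by right | left].
  by exists (n - N)%N => //; lia.
- exists [:: (1, N)%N]; split; first by move=> ab; rewrite inE => /eqP->.
  apply/seteqP; split=> [n Sn|n [ab /=]]; last by rewrite inE => /eqP->.
  by exists (1, N)%N; rewrite //= inE.
- by apply: zero_density_sub (zero_density_lt N) => n [].
Qed.

(** * Noetherian spaces and return times of continuous maps *)

Definition noetherian_space (T : topologicalType) : Prop :=
  forall F : nat -> set T, (forall n, closed (F n)) ->
    (forall n, F n.+1 `<=` F n) -> exists N, F N `<=` F N.+1.

(** A failing [Z] contains a strictly smaller failing closed set, so dependent choice yields a
    descending chain with no stationary step. *)
Lemma noetherian_space_ind (T : topologicalType) (P : set T -> Prop) :
  noetherian_space T ->
  (forall Z, closed Z ->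
    (forall W, closed W -> W `<=` Z -> ~ (Z `<=` W) -> P W) -> P Z) ->
  forall Z, closed Z -> P Z.
Proof.
move=> noeth IH Z0 cZ0; apply: contrapT => nPZ0.
pose bad := {Z : set T | closed Z /\ ~ P Z}.
have next (Z : bad) :
    {W : bad | sval W `<=` sval Z /\ ~ (sval Z `<=` sval W)}.
  case: Z => Z [cZ nPZ]; apply: cid; apply: contrapT => nW; apply: (nPZ).
  apply: IH => // W cW WZ nZW; apply: contrapT => nPW; apply: nW.
  by exists (exist _ W (conj cW nPW)).
have [F [_ FS]] := dependent_choice next (exist _ Z0 (conj cZ0 nPZ0)).
have [|n|N] := noeth (fun n => sval (F n)).
- by move=> n; case: (svalP (F n)).
- by case: (FS n).
- by case: (FS N).
Qed.

Lemma closed_preimage_iter (T : topologicalType) (f : T -> T) (n : nat) W :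
  continuous f -> closed W -> closed (iter n f @^-1` W).
Proof.
move=> /continuous_closedP cf; elim: n W => // n IH W cW.
exact: (IH _ (cf _ cW)).
Qed.

Lemma arith_prog_return_times (T : topologicalType) (f : T -> T) (x : T) :
  noetherian_space T -> continuous f -> forall W, closed W ->
  ~ zero_density [set n | W (iter n f x)] ->
  exists a b, (0 < b)%N /\ forall l, W (iter (b * l + a) f x).
Proof.
move=> noeth cf; apply: noetherian_space_ind => // W cW IH nzW.
have [j j0 nzj] : exists2 j, (0 < j)%N &
    ~ zero_density [set n | (W `&` iter j f @^-1` W) (iter n f x)].
  apply: contrapT => nj; apply: nzW; apply: zero_density_shift => j j0.
  apply: contrapT => nzj; apply: nj; exists j => // zj; apply: nzj.
  by apply: zero_density_sub zj => n [Wn]; rewrite /= addnC iterD.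
have cWj : closed (W `&` iter j f @^-1` W).
  by apply: closedI => //; apply: closed_preimage_iter.
(* Either [iter j f] maps [W] into itself, and a single visit starts a progression of difference
   [j], or the intersection is strictly smaller and induction applies to it. *)
have [WWj|nWWj] := pselect (W `<=` W `&` iter j f @^-1` W); last first.
  have [a [b [b0 h]]] := IH _ cWj (@subIsetl _ _ _) nWWj nzj.
  by exists a, b; split=> // l; case: (h l).
have [a Wa] : exists a, W (iter a f x).
  apply: contrapT => nW; apply: nzW; apply: zero_density_sub zero_density0 => n Wn.
  by apply: nW; exists n.
exists a, j; split=> // l; elim: l => [|l /WWj[_ /=]]; first by rewrite muln0.
by rewrite -iterD mulnS addnA.
Qed.

(* Induction on the closed set [Z] containing the orbit, for all maps at once.
   If [V] contains [f^(b l + a) x] for all [l], split the orbit into its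
   subprogressions mod [b].  If one of them is dense in [Z], then some [f^j]
   maps it into [V], hence maps [Z] into [V], and the orbit stays in [V] from
   time [j] on. *)
Lemma ap_mod_zero_return_times (T : topologicalType) (V : set T) :
  noetherian_space T -> closed V -> forall Z, closed Z ->
  forall (f : T -> T) (x : T), continuous f -> (forall n, Z (iter n f x)) ->
  ap_mod_zero [set n | V (iter n f x)].
Proof.
move=> noeth cV; apply: noetherian_space_ind => // Z cZ IH f x cf Zx.
have [|nz] := pselect (zero_density [set n | V (iter n f x)]).
  exact: ap_mod_zero_zero.
have [a [b [b0 Vab]]] := arith_prog_return_times _ _ x noeth cf _ cV nz.
pose C r := closure (range (fun l => iter (b * l + r) f x)).
have CZ r : C r `<=` Z.
  by rewrite [Z in _ `<=` Z](closure_id _).1//; apply: closureS => _ [l _ <-].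
have [[r ZC]|nZC] := pselect (exists r, Z `<=` C r); last first.
  apply: (@ap_mod_zero_residues b) => // r.
  have iterE l : iter l (iter b f) (iter r f x) = iter (b * l + r) f x.
    by rewrite iterD mulnC iterM.
  (* The orbit of [iter r f x] under [iter b f] lies in [C r], a proper closed subset of [Z]. *)
  have := IH (C r) (@closed_closure _ _) (CZ r) _ (iter b f) (iter r f x).
  have -> : [set n | V (iter n (iter b f) (iter r f x))] =
            [set l | V (iter (b * l + r) f x)].
    by apply/seteqP; split=> n /=; rewrite iterE.
  apply.
  - by move=> ZC; apply: nZC; exists r.
  - by apply/continuous_closedP => W cW; apply: closed_preimage_iter.
  - by move=> n; rewrite iterE; apply: subset_closure; exists n.
(* Chosen so that [j + (b * l + r)] equals [b * (l + r) + a]; the subtraction is not truncated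
   because [b] is positive. *)
pose j := (a + b * r - r)%N.
have VZ : Z `<=` iter j f @^-1` V.
  apply: subset_trans ZC _.
  rewrite (closure_id (iter j f @^-1` V)).1; last exact: closed_preimage_iter.
  apply: closureS => _ [l _ <-] /=; rewrite -iterD.
  have -> : (j + (b * l + r) = b * (l + r) + a)%N by rewrite /j; nia.
  exact: Vab.
apply: (@ap_mod_zero_cofinite j) => n jn /=.
by rewrite -(subnKC jn) iterD; apply: VZ.
Qed.

(** * Noetherian rings and the Hilbert basis theorem *)

Definition is_ideal {A : comNzRingType} (I : set A) : Prop :=
  I 0 /\ forall a u v, I u -> I v -> I (a * u + v).

Definition noetherian_ring (A : comNzRingType) : Prop :=
  forall I : nat -> set A, (forall n, is_ideal (I n)) ->
    (forall m n, (m <= n)%N -> I m `<=` I n) ->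
    exists N, forall n, (N <= n)%N -> I n `<=` I N.

(** A nonzero ideal contains a unit, so a chain is stationary from any nonzero member on. *)
Lemma noetherian_field (k : fieldType) : noetherian_ring k.
Proof.
move=> I idI mono.
have [[N [c [c0 IN]]]|h] := pselect (exists N c, c != 0 /\ I N c).
  exists N => n _ x _; have [IN0 INM] := idI N.
  by have := INM (x / c) _ _ IN IN0; rewrite divfK// addr0.
exists 0%N => n _ x Ix; have [->|x0] := eqVneq x 0; first exact: (idI 0%N).1.
by case: h; exists n, x.
Qed.

Lemma noetherian_image (A B : comNzRingType) (f : {rmorphism A -> B}) :
  (forall y, exists x, f x = y) -> noetherian_ring A -> noetherian_ring B.
Proof.
move=> fsurj noeth I idI mono.
have [|m n mn x|N hN] := noeth (fun n => f @^-1` I n).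
- move=> n; have [I0 IM] := idI n; split=> [|a u v Iu Iv] /=.
    by rewrite rmorph0.
  by rewrite rmorphD rmorphM; apply: IM.
- exact: mono.
- by exists N => n Nn y; have [x <-] := fsurj y; apply: hN.
Qed.

(** For an ideal [I], these are the leading coefficients of its members of degree [d], together with
    0. Bounding the size rather than fixing it keeps the set closed under addition. *)
Definition lead_ideal {A : comNzRingType} (I : set {poly A}) (d : nat) : set A :=
  [set a | exists p, [/\ I p, (size p <= d.+1)%N & p`_d = a]].

Lemma lead_ideal_ideal (A : comNzRingType) (I : set {poly A}) d :
  is_ideal I -> is_ideal (lead_ideal I d).
Proof.
move=> [I0 IM]; split; first by exists 0; rewrite size_poly0 coef0.
move=> a _ _ [p [Ip sp <-]] [q [Iq sq <-]]; exists (a%:P * p + q); split.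
- exact: IM.
- apply/leq_sizeP => j dj; rewrite coefD coefCM.
  by rewrite (leq_sizeP _ _ sp)// (leq_sizeP _ _ sq)// mulr0 addr0.
- by rewrite coefD coefCM.
Qed.

(** Multiplication by ['X^(e - d)] moves the coefficient from degree [d] to degree [e] and stays in
    [J]. *)
Lemma lead_ideal_sub (A : comNzRingType) (I J : set {poly A}) d e :
  is_ideal J -> I `<=` J -> (d <= e)%N -> lead_ideal I d `<=` lead_ideal J e.
Proof.
move=> [J0 JM] IJ de _ [p [/IJ Jp sp <-]]; exists ('X^(e - d) * p); split.
- by rewrite -[_ * p]addr0; apply: JM.
- apply/leq_sizeP => j ej; rewrite coefXnM; case: ifP => // _.
  by apply: (leq_sizeP _ _ sp); lia.
- by rewrite coefXnM ltnNge leq_subr /= subKn.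
Qed.

(** Subtracting from [p] in [J] a member of [I] with the same top coefficient lowers the size bound
    and stays in [J]; induct on that bound. *)
Lemma eq_lead_ideal (A : comNzRingType) (I J : set {poly A}) :
  is_ideal I -> is_ideal J -> I `<=` J ->
  (forall d, lead_ideal J d `<=` lead_ideal I d) -> J `<=` I.
Proof.
move=> [I0 IM] [J0 JM] IJ lJI p; move: {2}(size p) (leqnn (size p)) => n.
elim: n p => [|n IH] p sp Jp.
  by move: sp; rewrite leqn0 size_poly_eq0 => /eqP->.
have [q [Iq sq qn]] : lead_ideal I n p`_n by apply: lJI; exists p.
have : I (-1 * q + p).
  apply: IH; last by apply: JM => //; apply: IJ.
  apply/leq_sizeP => j; rewrite mulN1r coefD coefN leq_eqVlt => /orP[/eqP<-|nj].
    by rewrite qn addNr.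
  by rewrite (leq_sizeP _ _ sp)// (leq_sizeP _ _ sq)// oppr0 addr0.
by move=> /(IM 1 _ _ Iq); rewrite mul1r mulN1r addrA subrr add0r.
Qed.

(* The diagonal chain of leading ideals controls all degrees [d >= N] at once;
   the finitely many degrees [d < N] are stabilised one at a time. *)
Theorem hilbert_basis (A : comNzRingType) :
  noetherian_ring A -> noetherian_ring {poly A}.
Proof.
move=> noeth I idI mono.
pose L n d := lead_ideal (I n) d.
have idL n d : is_ideal (L n d) by apply: lead_ideal_ideal.
have monoL m n d e : (m <= n)%N -> (d <= e)%N -> L m d `<=` L n e.
  by move=> mn de; apply: lead_ideal_sub => //; apply: mono.
have [|m n mn|N hN] := noeth (fun n => L n n); [by []|exact: monoL|].
have [M hM] : exists M, forall d n, (d < N)%N -> (M <= n)%N -> L n d `<=` L M d.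
  elim: {hN}N => [|N [M hM]]; first by exists 0%N.
  have [|m n mn|M' hM'] := noeth (L ^~ N); [by []|exact: monoL|].
  exists (maxn M M') => d n; rewrite ltnS leq_eqVlt geq_max.
  move=> /orP[/eqP->|dN] /andP[Mn M'n].
    by apply: subset_trans (hM' n M'n) _; apply: monoL; rewrite ?leq_maxr.
  by apply: subset_trans (hM d n dN Mn) _; apply: monoL; rewrite ?leq_maxl.
exists (maxn M N) => n; rewrite geq_max => /andP[Mn Nn].
apply: eq_lead_ideal => //; first by apply: mono; rewrite geq_max Mn.
move=> d; have [dN|Nd] := ltnP d N.
  by apply: subset_trans (hM d n dN Mn) _; apply: monoL; rewrite ?leq_maxl.
(* For [d >= N], go up to the diagonal at [maxn n d], back to [L N N] by stability, then up to
   degree [d]. *)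
apply: (@subset_trans _ (L (maxn n d) (maxn n d))).
  by apply: monoL; rewrite ?leq_maxl ?leq_maxr.
apply: subset_trans (hN _ _) _; first by rewrite leq_max Nn.
by apply: monoL; rewrite ?leq_maxr.
Qed.

(** Adjoining the generators one by one maps an iterated polynomial ring over [k] to [R]; its image
    is a subalgebra containing [s], hence all of [R]. *)
Lemma noetherian_fin_gen_alg (k : fieldType) (R : comAlgType k) :
  fin_gen_alg R -> noetherian_ring R.
Proof.
move=> [s genR].
have [A [f [noeth fk fs]]] : exists (A : comNzRingType) (f : {rmorphism A -> R}),
    [/\ noetherian_ring A, forall c : k, exists a, f a = c%:A &
        forall x, x \in s -> exists a, f a = x].
  elim: s {genR} => [|x s [A [f [noeth fk fs]]]].
    exists k, (in_alg R); split=> //; first exact: noetherian_field.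
    by move=> c; exists c.
  have cfx : commr_rmorph f x by move=> a; apply: mulrC.
  exists {poly A}, (horner_morph cfx); split; first exact: hilbert_basis.
    by move=> c; have [a <-] := fk c; exists a%:P; rewrite /= horner_morphC.
  move=> y; rewrite inE => /orP[/eqP->|/fs[a <-]].
    by exists 'X; rewrite /= horner_morphX.
  by exists a%:P; rewrite /= horner_morphC.
apply: (@noetherian_image _ _ f) => // y.
suff /asboolP : y \in (fun y => `[< exists x, f x = y >] : bool) by [].
apply: genR => [|x /fs]; last by move=> ?; apply/asboolP.
split.
- by apply/asboolP; exists 1; rewrite rmorph1.
- move=> c _ _ /asboolP[u <-] /asboolP[v <-]; apply/asboolP.
  have [a fa] := fk c; exists (a * u + v).
  by rewrite rmorphD rmorphM fa mulr_algl.
- move=> _ _ /asboolP[u <-] /asboolP[v <-]; apply/asboolP.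
  by exists (u * v); rewrite rmorphM.
Qed.

(** * Topology of the spectrum, and the conclusion *)

Lemma noetherian_spec (R : comNzRingType) :
  noetherian_ring R -> noetherian_space (spec R).
Proof.
move=> noeth F cF decF.
(* The vanishing ideals of the [F n] increase. Where they stop growing, the equations [E] of the
   next closed set already vanish on the current one. *)
pose I n : set R := [set x | forall p, F n p -> spec_ideal p x].
have [|m n mn|N hN] := noeth I.
- move=> n; split=> [p _|a u v Iu Iv p Fp]; first exact: idealr0.
  apply: rpredD; last exact: Iv.
  by apply: idealMr; apply: Iu.
- move=> x Ix p; move: mn => /subnK<-; elim: (n - m)%N => [|i IH]; first exact: Ix.
  by rewrite addSn => /decF.
- exists N => p Fp; have [E FE] := (zariski_closedP _).1 (cF N.+1).
  rewrite FE => x Ex; apply: (hN N.+1 (leqnSn N)) Fp => q.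
  by rewrite FE; apply.
Qed.

(** The preimage of the zero locus of [E] is the zero locus of the image of [E] under [Phi]. *)
Lemma continuous_spec_map (k : fieldType) (R : comAlgType k)
  (Phi : {lrmorphism R -> R}) : continuous (spec_map Phi).
Proof.
apply/continuous_closedP => V /zariski_closedP[E ->]; apply/zariski_closedP.
exists (Phi @` E); apply/seteqP; split=> p /= h; first by move=> _ [x Ex <-]; apply: h.
by move=> x Ex; apply: h; exists x.
Qed.

Theorem theorem2 (K : realType) (k : fieldType) (R : comAlgType k)
    (hR : fin_gen_alg R) (Phi : {lrmorphism R -> R})
    (alpha : spec R) (V : set (spec R)) (hV : closed V) :
  exists A B : set nat,
    [/\ [set n | V (iter n (spec_map Phi) alpha)] = A `|` B,
        fin_union_arith_prog A
      & banach_density K B = 0%E].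
Proof.
have noeth := noetherian_spec _ (noetherian_fin_gen_alg _ _ hR).
(* The induction starts from the whole spectrum, which trivially contains the orbit. *)
have [A [B [eqS apA zB]]] := ap_mod_zero_return_times _ _ noeth hV _ closedT
  _ alpha (continuous_spec_map _ _ Phi) (fun=> I).
by exists A, B; split=> //; apply: banach_density_eq0.
Qed.
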